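(* Let $B\in\mathbb{R}^{X\times X}$ be the projected transition matrix of a two-reflection walk, with spectral decomposition $B=\sum_\theta \theta E_\theta$. Let $u,v\in X$ be distinct, let $$\Lambda^1=\{\theta\mid E_\theta(u,v)>0\},\qquad \Lambda^{-1}=\{\theta\mid E_\theta(u,v)<0\},\qquad \Lambda=\Lambda^1\cup\Lambda^{-1},$$ and assume $\Lambda\neq\emptyset$. There is peak state transfer from $u$ to $v$ at some time if and only if both of the following hold: (i) Each $\theta\in\Lambda$ is a cosine of a rational multiple of $\pi$: it can be (uniquely) written as $\theta=\cos\frac{p(\theta)\pi}{q(\theta)}$, where $p(\theta)\ge 0$ and $q(\theta)>0$ are integers such that $p(\theta)\le q(\theta)$ and $\gcd(p(\theta),q(\theta))=1$. (ii) Let $\tau=\operatorname{lcm}\{q(\theta)\mid\theta\in\Lambda\}$. For some choice of $\gamma\in\{-1,1\}$, and all $\theta\in\Lambda$: (a) $\theta\in\Lambda^{\gamma}$ if and only if the integer $\tau\cdot\frac{p(\theta)}{q(\theta)}$ is even; (b) $\theta\in\Lambda^{-\gamma}$ if and only if the integer $\tau\cdot\frac{p(\theta)}{q(\theta)}$ is odd. If there is peak state transfer from $u$ to $v$, it occurs precisely at all times that are (positive) odd multiples of $\tau$. This is perfect state transfer if and only if, in addition to (i) and (ii), $u$ and $v$ are strongly cospectral with respect to $B$.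
   Context: Two-reflection walk (real case): $\mathcal{A},X,Y$ are finite sets, $N\in\mathbb{R}^{\mathcal{A}\times X}$ and $M\in\mathbb{R}^{\mathcal{A}\times Y}$ are matrices with orthonormal columns ($N^TN=I$, $M^TM=I$), and the transition matrix is $U=(2MM^T-I)(2NN^T-I)$. For integers $t\ge 0$ put $B_t=N^TU^tN$, which is a symmetric real matrix; the projected transition matrix is $B=B_1$. Spectral decomposition: $B=\sum_\theta\theta E_\theta$, the sum running over the distinct eigenvalues $\theta$ of $B$, with $E_\theta$ the orthogonal projection onto the $\theta$-eigenspace. $\Lambda^{1},\Lambda^{-1},\Lambda$ are called the positive, negative and (full) mutual eigenvalue support of $u$ and $v$. Times are positive integers. For distinct $u,v\in X$ (with $\Lambda\ne\emptyset$), there is peak state transfer from $u$ to $v$ at time $t$ if $|B_t(u,v)|=\sum_\theta|E_\theta(u,v)|$. There is perfect state transfer from $u$ to $v$ at time $t$ if $U^tN\mathbf{e}_u=\gamma N\mathbf{e}_v$ for some $\gamma\in\mathbb{C}$ with $|\gamma|=1$ (equivalently $|B_t(u,v)|=1$), where $\mathbf{e}_x$ denotes the standard basis vector indexed by $x$. The indices $u,v$ are strongly cospectral with respect to $B$ if for every eigenvalue $\theta$ of $B$, $E_\theta\mathbf{e}_u=E_\theta\mathbf{e}_v$ or $E_\theta\mathbf{e}_u=-E_\theta\mathbf{e}_v$. *)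

(* Defs.v *)
From HB Require Import structures.
From mathcomp Require Import all_boot all_order all_algebra.
From mathcomp Require Import complex.
From mathcomp Require Import all_classical all_reals all_analysis.

Set Implicit Arguments.
Unset Strict Implicit.
Unset Printing Implicit Defensive.

Import Order.TTheory GRing.Theory Num.Theory.

Local Open Scope classical_set_scope.
Local Open Scope ring_scope.

Section LinearAlgebra.
Variables (R : realType) (n : nat).

Definition stdvec (F : pzSemiRingType) (x : 'I_n) : 'cV[F]_n := delta_mx x 0.

(* [kermx W^T] is the orthogonal complement of the row space of [W].  The
   matrix of an orthogonal projection is symmetric, so it does not matter that
   [proj_mx] acts on row vectors. *)
Definition orthoproj (W : 'M[R]_n) : 'M[R]_n := proj_mx W (kermx W^T).

(* [eigenspace] is a left (row) eigenspace; it is used below for symmetric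
   matrices only. *)
Definition eigproj (B : 'M[R]_n) (theta : R) : 'M[R]_n :=
  orthoproj (eigenspace B theta).

Definition strongly_cospectral (B : 'M[R]_n) (u v : 'I_n) : Prop :=
  forall theta : R, eigenvalue B theta ->
    eigproj B theta *m stdvec R u = eigproj B theta *m stdvec R v \/
    eigproj B theta *m stdvec R u = - (eigproj B theta *m stdvec R v).

Definition msupp_pos (B : 'M[R]_n) (u v : 'I_n) : set R :=
  [set theta | eigenvalue B theta /\ 0 < eigproj B theta u v].

Definition msupp_neg (B : 'M[R]_n) (u v : 'I_n) : set R :=
  [set theta | eigenvalue B theta /\ eigproj B theta u v < 0].

Definition msupp (B : 'M[R]_n) (u v : 'I_n) : set R :=
  msupp_pos B u v `|` msupp_neg B u v.

(* Only meaningful for [gamma = 1] and [gamma = -1]. *)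
Definition msupp_sign (B : 'M[R]_n) (u v : 'I_n) (gamma : int) : set R :=
  if gamma == 1 then msupp_pos B u v else msupp_neg B u v.

End LinearAlgebra.

Section CosineRepresentation.
Variable R : realType.

Definition is_cos_rep (theta : R) (pq : nat * nat) : Prop :=
  [/\ (0 < pq.2)%N, (pq.1 <= pq.2)%N, coprime pq.1 pq.2 &
      theta = cos (pq.1%:R * pi / pq.2%:R)].

(* The pair (p(theta), q(theta)), with the junk value (0, 1) when [theta] is
   not the cosine of a rational multiple of pi. *)
Definition cos_rep (theta : R) : nat * nat :=
  xget (0%N, 1%N) [set pq | is_cos_rep theta pq].

Definition cos_num (theta : R) : nat := (cos_rep theta).1.
Definition cos_den (theta : R) : nat := (cos_rep theta).2.

Variables (n : nat) (B : 'M[R]_n) (u v : 'I_n).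

Definition support_cosines : Prop :=
  forall theta : R, msupp B u v theta ->
    exists! pq : nat * nat, is_cos_rep theta pq.

Definition support_lcm : nat :=
  \big[lcmn/1%N]_(theta \in msupp B u v) cos_den theta.

(* The division is exact: [cos_den theta] divides [support_lcm]. *)
Definition support_multiple (theta : R) : nat :=
  (support_lcm * cos_num theta) %/ cos_den theta.

Definition support_parity : Prop :=
  exists gamma : int, (gamma = 1 \/ gamma = -1) /\
    forall theta : R, msupp B u v theta ->
      (msupp_sign B u v gamma theta <-> ~~ odd (support_multiple theta)) /\
      (msupp_sign B u v (- gamma) theta <-> odd (support_multiple theta)).

End CosineRepresentation.

Section TwoReflectionWalk.
Variables (R : realType) (a x y : nat).
Variables (N : 'M[R]_(a, x)) (M : 'M[R]_(a, y)).

Definition transition : 'M[R]_a :=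
  (2 *: (M *m M^T) - 1%:M) *m (2 *: (N *m N^T) - 1%:M).

Definition projected_power (t : nat) : 'M[R]_x :=
  N^T *m transition ^+ t *m N.

Definition projected_transition : 'M[R]_x := projected_power 1.

Definition peak_state_transfer (u v : 'I_x) (t : nat) : Prop :=
  `|projected_power t u v| =
  \sum_(theta \in [set theta | eigenvalue projected_transition theta])
     `|eigproj projected_transition theta u v|.

Definition perfect_state_transfer (u v : 'I_x) (t : nat) : Prop :=
  exists2 gamma : R[i], `|gamma| = 1 &
    map_mx (real_complex R) (transition ^+ t *m N) *m stdvec R[i] u =
    gamma *: (map_mx (real_complex R) N *m stdvec R[i] v).

End TwoReflectionWalk.

(* Main.v *)
Require Import Defs.
From HB Require Import structures.
From mathcomp Require Import all_boot all_order all_algebra.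
From mathcomp Require Import complex.
From mathcomp Require Import all_classical all_reals all_analysis.
From mathcomp Require Import ring lra.

Set Implicit Arguments.
Unset Strict Implicit.
Unset Printing Implicit Defensive.

Import Order.TTheory GRing.Theory Num.Theory.

Local Open Scope classical_set_scope.
Local Open Scope ring_scope.

(** The powers of the walk satisfy a Chebyshev recursion.  Write
    [B_t = N^T U^t N] and let [S = 2 N N^T - 1], [Q = 2 M M^T - 1], so that
    [U = Q S].  Both reflections are involutions and [S] fixes the columns of
    [N], whence [B_(t+2) = 2 B B_(t+1) - B_t] ([projected_power_rec]).  Since
    [B = N^T Q N] is symmetric with spectrum in [-1, 1], this gives
    [B_t = sum_theta cos (t acos theta) E_theta] ([projected_power_spectral]).

    The triangle inequality for
    [B_t(u,v) = sum_theta cos (t acos theta) E_theta(u,v)] is an equality exactly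
    when, for some global sign, every [cos (t acos theta)] with [theta] in the
    support is that sign times the sign of [E_theta(u,v)] ([peakE]).  In
    particular [|cos (t acos theta)| = 1], so [t acos theta] is a multiple of
    [pi]: [theta] is the cosine of some [p pi / q] in lowest terms, [q] divides
    [t], and the cosine is the parity sign of [t p / q] (section
    [RationalAngles]).  Hence [t] is a multiple [k tau] of the least common
    multiple [tau] of the denominators.  An even [k] would make all these cosines equal
    to 1 and hence all [E_theta(u,v)] of one sign, whereas they sum to the
    off-diagonal entry [(u,v)] of the identity ([msupp_both_signs]); so [k] is
    odd, and then the parity of [t p / q] is that of [tau p / q]
    ([peak_conditions]).  The same computation, read backwards, gives the converse
    ([peak_odd_multiple]).

    Perfect state transfer means [|B_t(u,v)| = 1], by the equality case of
    Cauchy-Schwarz ([perfectE]).  Since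
    [|E_theta(u,v)| <= (E_theta(u,u) + E_theta(v,v)) / 2] and the right-hand
    sides sum to 1, it amounts to peak state transfer together with equality for
    each [theta], that is, with [E_theta e_u = +/- E_theta e_v]. *)

(** * Diagonalization of real symmetric matrices *)

Section RealSpectralTheorem.
Variable R : realType.

Lemma row_norm_eq0 n (w : 'rV[R]_n) : w *m w^T = 0 -> w = 0.
Proof.
move=> /matrixP/(_ 0 0); rewrite !mxE => /eqP.
rewrite psumr_eq0 => [/allP h|i _]; last by rewrite mxE -expr2 sqr_ge0.
apply/rowP => i; have := h i (mem_index_enum _).
by rewrite !mxE implyTb mulf_eq0 orbb => /eqP.
Qed.

Lemma col_norm_ge0 n (w : 'cV[R]_n) : 0 <= (w^T *m w) 0 0.
Proof. by rewrite mxE sumr_ge0 // => k _; rewrite mxE -expr2 sqr_ge0. Qed.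

Lemma col_norm_eq0 n (w : 'cV[R]_n) : (w^T *m w) 0 0 = 0 -> w = 0.
Proof.
move=> h; apply: trmx_inj; rewrite trmx0; apply: row_norm_eq0; rewrite trmxK.
by apply/matrixP => i j; rewrite !ord1 h mxE.
Qed.

(** A real symmetric matrix is Hermitian over [R[i]], hence diagonalizable there
    with real eigenvalues, so the product of the [X - r] over these eigenvalues
    annihilates it, already over [R]. *)
Lemma symmetric_diagonalizable n (A : 'M[R]_n) : A^T = A -> diagonalizable A.
Proof.
move=> As; case: n A As => [A _|n A As].
  by rewrite [A]flatmx0; exact: diagonalizable0.
apply/diagonalizableP.
pose f := real_complex R.
have hA : map_mx f A \is hermsymmx.
  apply: realsym_hermsym.
    by apply/is_hermitianmxP; rewrite expr0 scale1r map_mx_id // map_trmx As.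
  by apply/mxOverP => i j; rewrite mxE; apply/complex_realP; exists (A i j).
have /orthomx_spectralP Adiag := hermitian_normalmx hA.
have /mxOverP dreal := hermitian_spectral_diag_real hA.
set P := spectralmx _ in Adiag; set d := spectral_diag _ in Adiag dreal.
have Pu : P \in unitmx by exact: spectral_unit.
pose rs := undup [seq complex.Re (d 0 i) | i <- enum 'I_n.+1].
exists rs; first exact: undup_uniq.
apply/mxminpoly_min/(map_mx_inj (f := f)); rewrite map_mx0 map_horner_mx [map_mx f A]Adiag.
rewrite (horner_mx_uconjC _ _ Pu) horner_mx_diag.
rewrite (_ : map_mx _ d = 0) ?linear0 ?mulmx0 ?mul0mx //.
apply/rowP => i; rewrite !mxE rmorph_prod /= horner_prod.
apply/eqP; rewrite prodf_seq_eq0; apply/hasP; exists (complex.Re (d 0 i)).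
  by rewrite mem_undup; apply/mapP; exists i; rewrite ?mem_enum.
by rewrite andTb rmorphB /= map_polyX map_polyC /= hornerXsubC /f /= RRe_real ?subrr // dreal.
Qed.

End RealSpectralTheorem.

(** * Orthogonal projections onto eigenspaces *)

Section EigenProjections.
Variables (R : realType) (n : nat).
Implicit Types (A W : 'M[R]_n) (r s : R).

Lemma cap_orthocompl0 W : (W :&: kermx W^T = 0)%MS.
Proof.
apply/eqP/rowV0P => w; rewrite sub_capmx => /andP[/submxP[D ->]] /sub_kermxP.
by move=> /(congr1 (mulmx^~ D^T)); rewrite mul0mx -mulmxA -trmx_mul => /row_norm_eq0.
Qed.

Lemma orthoproj_id m W (V : 'M[R]_(m, n)) : (V <= W)%MS -> V *m orthoproj W = V.
Proof. by move=> VW; rewrite /orthoproj proj_mx_id ?cap_orthocompl0. Qed.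

Lemma orthoproj_0 m W (V : 'M[R]_(m, n)) : V *m W^T = 0 -> V *m orthoproj W = 0.
Proof. by move=> VW; rewrite /orthoproj proj_mx_0 ?cap_orthocompl0 //; exact/sub_kermxP. Qed.

Lemma orthoproj_sub W : (orthoproj W <= W)%MS.
Proof. by rewrite -[orthoproj W]mul1mx proj_mx_sub. Qed.

Lemma eigproj_id m A r (V : 'M[R]_(m, n)) : V *m A = r *: V -> V *m eigproj A r = V.
Proof. by move=> VA; apply: orthoproj_id; apply/eigenspaceP. Qed.

Lemma eigprojA A r : eigproj A r *m A = r *: eigproj A r.
Proof. by apply/eigenspaceP; exact: orthoproj_sub. Qed.

Lemma eigproj_eq0 A r : ~~ eigenvalue A r -> eigproj A r = 0.
Proof.
rewrite negbK => /eqP A0; apply/eqP; rewrite -submx0 -A0; exact: orthoproj_sub.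
Qed.

Lemma eigenvectors_orthogonal m1 m2 A r s (V : 'M[R]_(m1, n)) (W : 'M[R]_(m2, n)) :
  A^T = A -> r != s -> V *m A = r *: V -> W *m A = s *: W -> V *m W^T = 0.
Proof.
move=> As rs VA WA; apply/eqP.
have : r *: (V *m W^T) = s *: (V *m W^T).
  by rewrite scalemxAl -VA -mulmxA -{1}As -trmx_mul WA linearZ /= -scalemxAr.
by move/eqP; rewrite -subr_eq0 -scalerBl scaler_eq0 subr_eq0 (negbTE rs).
Qed.

Lemma eigproj_0 m A r s (V : 'M[R]_(m, n)) :
  A^T = A -> s != r -> V *m A = s *: V -> V *m eigproj A r = 0.
Proof.
move=> As sr VA; apply: orthoproj_0; apply: (eigenvectors_orthogonal As sr VA).
exact/eigenspaceP.
Qed.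

(** The matrices [eigproj A r], for [r] in the spectrum of the symmetric matrix
    [A], resolve the identity. *)
Lemma spectral_resolution A : A^T = A ->
  exists rs, [/\ uniq rs, forall r, (r \in rs) = eigenvalue A r &
                 \sum_(r <- rs) eigproj A r = 1%:M].
Proof.
move=> As; have /diagonalizablePeigen[rs urs rs1] := symmetric_diagonalizable As.
have sum1 : \sum_(r <- rs) eigproj A r = 1%:M.
  (* The defect of the sum from [1%:M] kills every eigenspace, and these span. *)
  apply/eqP; rewrite -subr_eq0 -[X in X == 0]mul1mx; apply/eqP/sub_kermxP.
  rewrite -rs1 big_seq_cond; elim/big_rec: _ => [|s V]; first exact: sub0mx.
  rewrite andbT addsmx_sub => srs ->; rewrite andbT; apply/sub_kermxP.
  have WA : eigenspace A s *m A = s *: eigenspace A s by exact/eigenspaceP.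
  rewrite mulmxBr mulmx1 mulmx_sumr (bigD1_seq s) //= eigproj_id // big1 ?addr0 ?subrr //.
  by move=> r rs'; apply: eigproj_0 WA; rewrite // eq_sym.
(* [rs] may contain scalars that are not eigenvalues; their eigenspaces are 0. *)
exists [seq r <- rs | eigenvalue A r]; split; first exact: filter_uniq.
  move=> r; rewrite mem_filter; case: (boolP (eigenvalue A r)) => //= /eigenvalueP[w wA w0].
  apply/negPn/negP => rrs; move/eqP: w0; apply; rewrite -[w]mulmx1 -sum1 mulmx_sumr big_seq big1 //.
  by move=> s srs; apply: eigproj_0 wA => //; apply: contraNneq rrs => ->.
rewrite big_filter -sum1 [RHS](bigID (eigenvalue A)) /= [X in _ + X]big1 ?addr0 //.
by move=> r; exact: eigproj_eq0.
Qed.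

Lemma eigproj_orthogonal A r s : A^T = A -> r != s ->
  eigproj A r *m (eigproj A s)^T = 0.
Proof. by move=> As rs; exact: (eigenvectors_orthogonal As rs (eigprojA _ _) (eigprojA _ _)). Qed.

(** Multiply [E_r] by the transpose of the resolution of the identity: only the
    term of index [r] survives. *)
Lemma eigproj_mul_trmx A r : A^T = A -> eigproj A r = eigproj A r *m (eigproj A r)^T.
Proof.
move=> As; have [rs [urs mrs s1]] := spectral_resolution As.
case: (boolP (r \in rs)) => [rrs|]; last by rewrite mrs => /eigproj_eq0 ->; rewrite mul0mx.
rewrite -[LHS]mulmx1 -trmx1 -s1 (bigD1_seq r) //= linearD linear_sum mulmxDr mulmx_sumr /=.
rewrite [X in _ + X]big1 ?addr0 // => s sr.
by rewrite eigproj_orthogonal // eq_sym.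
Qed.

Lemma eigproj_symmetric A r : A^T = A -> (eigproj A r)^T = eigproj A r.
Proof. by move=> As; rewrite eigproj_mul_trmx // trmx_mul trmxK. Qed.

Lemma eigproj_idem A r : A^T = A -> eigproj A r *m eigproj A r = eigproj A r.
Proof. by move=> As; rewrite -{2}[eigproj A r]eigproj_symmetric // -eigproj_mul_trmx. Qed.

End EigenProjections.

Section EigenProjectionEntries.
Variables (R : realType) (n : nat) (B : 'M[R]_n).
Hypothesis B_sym : B^T = B.
Implicit Types (r s : R) (u v : 'I_n).

(** The squared norm of [E_r e_u - s E_r e_v], whose sign and vanishing give the
    bound on [E_r(u,v)] below and its equality case. *)
Lemma cospectral_defect r s u v : let w := col u (eigproj B r) - s *: col v (eigproj B r) in
  (w^T *m w) 0 0 = eigproj B r u u + s ^+ 2 * eigproj B r v v - 2 * s * eigproj B r u v.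
Proof.
move=> w; set E := eigproj B r.
have EE i j : E i j = \sum_k E k i * E k j.
  have /matrixP/(_ i j) := eigproj_idem r B_sym; rewrite -{1}(eigproj_symmetric r B_sym).
  by rewrite mxE => <-; apply: eq_bigr => k _; rewrite mxE.
rewrite mxE !(EE _ v) (EE u u) !mulr_sumr -big_split -sumrB /=.
by apply: eq_bigr => k _; rewrite !mxE; ring.
Qed.

Lemma eigproj_entry_le r u v :
  `|eigproj B r u v| <= (eigproj B r u u + eigproj B r v v) / 2.
Proof.
have := col_norm_ge0 (col u (eigproj B r) - 1 *: col v (eigproj B r)).
have := col_norm_ge0 (col u (eigproj B r) - (-1) *: col v (eigproj B r)).
rewrite !cospectral_defect ler_norml => *; apply/andP; split; lra.
Qed.

Lemma eigproj_entry_max r u v :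
  `|eigproj B r u v| = (eigproj B r u u + eigproj B r v v) / 2 ->
  eigproj B r *m stdvec R u = eigproj B r *m stdvec R v \/
  eigproj B r *m stdvec R u = - (eigproj B r *m stdvec R v).
Proof.
rewrite /stdvec -!colE => h.
have [p|p] := leP 0 (eigproj B r u v); [left|right].
  apply/eqP; rewrite -subr_eq0 -[col v _]scale1r; apply/eqP/col_norm_eq0.
  by rewrite cospectral_defect; rewrite ger0_norm // in h; lra.
suff : col u (eigproj B r) - (-1) *: col v (eigproj B r) = 0.
  by rewrite scaleN1r opprK => /eqP; rewrite addr_eq0 => /eqP.
apply: col_norm_eq0.
by rewrite cospectral_defect; rewrite ltr0_norm // in h; lra.
Qed.

Lemma cospectral_entry r u v :
  eigproj B r *m stdvec R u = eigproj B r *m stdvec R v \/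
  eigproj B r *m stdvec R u = - (eigproj B r *m stdvec R v) ->
  `|eigproj B r u v| = eigproj B r u u.
Proof.
rewrite /stdvec -!colE; set E := eigproj B r => h.
(* With [s = 0] the squared norm is [E u u]. *)
have pos : 0 <= E u u.
  have := col_norm_ge0 (col u E - 0 *: col v E); rewrite /E cospectral_defect; lra.
have Ecol i j : col i E j 0 = E j i by rewrite mxE.
case: h => /(congr1 (fun w : 'cV[R]_n => w u 0)) /=.
  by rewrite !Ecol => <-; rewrite ger0_norm.
by rewrite [RHS]mxE !Ecol => h; rewrite -normrN -h ger0_norm.
Qed.

End EigenProjectionEntries.

(** * The two-reflection walk *)

Section ReflectionWalk.
Variables (R : realType) (a x y : nat).
Variables (N : 'M[R]_(a, x)) (M : 'M[R]_(a, y)).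
Hypotheses (hN : N^T *m N = 1%:M) (hM : M^T *m M = 1%:M).

(** The reflection about the column space of [Z], for [Z] with orthonormal
    columns. *)
Definition reflection b (Z : 'M[R]_(a, b)) : 'M[R]_a := 2 *: (Z *m Z^T) - 1%:M.

Lemma reflection_tr b (Z : 'M[R]_(a, b)) : (reflection Z)^T = reflection Z.
Proof. by rewrite /reflection linearB linearZ /= trmx_mul trmxK trmx1. Qed.

Lemma reflection_id b (Z : 'M[R]_(a, b)) : Z^T *m Z = 1%:M -> reflection Z *m Z = Z.
Proof.
move=> hZ; rewrite /reflection mulmxBl mul1mx -scalemxAl -mulmxA hZ mulmx1.
by rewrite scaler_nat mulr2n addrK.
Qed.

Lemma reflection_idl b (Z : 'M[R]_(a, b)) : Z^T *m Z = 1%:M -> Z^T *m reflection Z = Z^T.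
Proof. by move=> hZ; have := congr1 trmx (reflection_id hZ); rewrite trmx_mul reflection_tr. Qed.

Lemma reflectionK b (Z : 'M[R]_(a, b)) : Z^T *m Z = 1%:M ->
  reflection Z *m reflection Z = 1%:M.
Proof.
move=> hZ; rewrite {2}/reflection mulmxBr mulmx1 -scalemxAr mulmxA reflection_id //.
by rewrite /reflection opprB addrC subrK.
Qed.

Local Notation U := (transition N M).
Local Notation B := (projected_transition N M).
Local Notation S := (reflection N).
Local Notation Q := (reflection M).

Lemma transition_pow_orthogonal t : (U ^+ t)^T *m U ^+ t = 1%:M.
Proof.
elim: t => [|t IH]; first by rewrite expr0 trmx1 mulmx1.
rewrite exprS -[U * _]/(U *m _) trmx_mul -mulmxA (mulmxA U^T) [U^T *m U](_ : _ = 1%:M) ?mul1mx //.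
rewrite -[U]/(Q *m S) trmx_mul !reflection_tr.
by rewrite mulmxA -(mulmxA S Q) reflectionK // mulmx1 reflectionK.
Qed.

Lemma projected_transitionE : B = N^T *m Q *m N.
Proof.
rewrite /projected_transition /projected_power expr1 -[U]/(Q *m S).
by rewrite -!mulmxA reflection_id.
Qed.

Lemma projected_transition_sym : B^T = B.
Proof. by rewrite projected_transitionE !trmx_mul reflection_tr trmxK mulmxA. Qed.

Lemma projected_power0 : projected_power N M 0 = 1%:M.
Proof. by rewrite /projected_power expr0 mulmx1. Qed.

(** The Chebyshev recursion of the projected powers: [U^-1 = S Q] turns
    [N^T U^t N] into [N^T Q U^(t+1) N], and
    [N^T U^(t+2) N = N^T Q S U^(t+1) N]; in the sum, [S + 1 = 2 N N^T]. *)
Lemma projected_power_rec t : projected_power N M t.+2 =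
  2 *: (B *m projected_power N M t.+1) - projected_power N M t.
Proof.
have UE : U = Q *m S by [].
have -> : projected_power N M t = N^T *m Q *m (U ^+ t.+1 *m N).
  rewrite /projected_power exprS -[U * _]/(U *m _) {2}UE -(mulmxA Q) mulmxA.
  rewrite (mulmxA _ Q) -(mulmxA _ Q Q) reflectionK // mulmx1.
  by rewrite (mulmxA _ S) reflection_idl.
rewrite [in RHS]/projected_power projected_transitionE.
rewrite /projected_power exprS -[U * _]/(U *m _) {1}UE.
have -> : 2 *: (N^T *m Q *m N *m (N^T *m U ^+ t.+1 *m N)) =
  N^T *m Q *m (2 *: (N *m N^T)) *m (U ^+ t.+1 *m N).
  by rewrite -scalemxAr -scalemxAl !mulmxA.
by rewrite -[RHS]mulmxBl -[X in _ - X]mulmx1 -mulmxBr !mulmxA.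
Qed.

(** [B] is both [2 A A^T - 1], with [A = N^T M], and [1 - 2 C C^T], with
    [C = N^T (1 - M M^T)]. *)
Lemma eigenvalue_projected r : eigenvalue B r -> -1 <= r <= 1.
Proof.
move=> /eigenvalueP[w wB w0].
have dge0 m (V : 'rV[R]_m) : 0 <= (V *m V^T) 0 0.
  by rewrite mxE sumr_ge0 // => i _; rewrite mxE -expr2 sqr_ge0.
have wgt0 : 0 < (w *m w^T) 0 0.
  rewrite lt_def dge0 andbT; apply: contra w0 => /eqP h.
  by apply/eqP/row_norm_eq0/matrixP => i j; rewrite !ord1 h mxE.
have wBw : (w *m B *m w^T) 0 0 = r * (w *m w^T) 0 0.
  by rewrite wB -scalemxAl mxE.
have E1 : (w *m B *m w^T) = 2 *: (w *m N^T *m M *m (w *m N^T *m M)^T) - w *m w^T.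
  rewrite projected_transitionE /reflection mulmxBr mulmxBl mulmx1 hN.
  rewrite mulmxBr mulmxBl mulmx1 -scalemxAr -scalemxAl -scalemxAr -scalemxAl.
  by rewrite !trmx_mul !trmxK !mulmxA.
pose P := 1%:M - M *m M^T.
have PP : P *m P^T = P.
  rewrite /P linearB /= trmx1 trmx_mul trmxK mulmxBr mulmx1 mulmxBl mul1mx mulmxA.
  by rewrite -(mulmxA M) hM mulmx1 subrr subr0.
have QP : reflection M = 1%:M - 2 *: P.
  by rewrite /P /reflection; apply/matrixP => i j; rewrite !mxE; ring.
have E2 : w *m B *m w^T = w *m w^T - 2 *: ((w *m N^T *m P) *m (w *m N^T *m P)^T).
  rewrite (trmx_mul (w *m N^T)) (trmx_mul w) trmxK -(mulmxA (w *m N^T)) (mulmxA P) PP.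
  rewrite projected_transitionE QP mulmxBr mulmxBl mulmx1 hN mulmxBr mulmxBl mulmx1.
  by rewrite -!scalemxAr -!scalemxAl -!scalemxAr -!scalemxAl !mulmxA.
have := dge0 _ (w *m N^T *m M); have := dge0 _ (w *m N^T *m P).
move: E1 E2 => /matrixP/(_ 0 0) + /matrixP/(_ 0 0); rewrite wBw.
rewrite [RHS]mxE [X in X + _]mxE [X in _ + X]mxE => E1.
rewrite [RHS]mxE [X in _ + X]mxE [X in _ - X]mxE => E2 P0 V0.
by apply/andP; split; nra.
Qed.

(** The factors [cos (t acos r)] are the values at [r] of the Chebyshev
    polynomials of the first kind. *)
Lemma projected_power_spectral rs :
  (forall r, (r \in rs) = eigenvalue B r) -> \sum_(r <- rs) eigproj B r = 1%:M ->
  forall t, projected_power N M t = \sum_(r <- rs) cos (t%:R * acos r) *: eigproj B r.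
Proof.
move=> mrs s1.
(* The recursion has order two, so two consecutive values are carried along. *)
suff h t : projected_power N M t = \sum_(r <- rs) cos (t%:R * acos r) *: eigproj B r /\
  projected_power N M t.+1 = \sum_(r <- rs) cos (t.+1%:R * acos r) *: eigproj B r.
  by move=> t; case: (h t).
have cosr r : r \in rs -> cos (acos r) = r.
  by rewrite mrs => /eigenvalue_projected hr; rewrite acosK // in_itv.
have BE r : B *m eigproj B r = r *: eigproj B r.
  apply/trmx_inj; rewrite trmx_mul linearZ /= eigproj_symmetric ?projected_transition_sym //.
  exact: eigprojA.
elim: t => [|t [IH0 IH1]]; split=> //.
- rewrite projected_power0 -s1; apply: eq_bigr => r _; by rewrite mul0r cos0 scale1r.
- rewrite -/(projected_transition N M) -[LHS]mulmx1 -s1 mulmx_sumr big_seq [RHS]big_seq.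
  by apply: eq_bigr => r rrs; rewrite BE mul1r cosr.
rewrite projected_power_rec IH0 IH1 mulmx_sumr scaler_sumr -sumrB big_seq [RHS]big_seq.
apply: eq_bigr => r rrs; rewrite -scalemxAr BE !scalerA -scalerBl; congr (_ *: _).
rewrite -{2}(cosr _ rrs).
have -> : t.+2%:R * acos r = t.+1%:R * acos r + acos r by rewrite -[t.+2]addn1 natrD; ring.
have -> : t%:R * acos r = t.+1%:R * acos r - acos r by rewrite -[t.+1]addn1 natrD; ring.
rewrite cosB cosD; ring.
Qed.

End ReflectionWalk.

(** * Cosines of rational multiples of pi *)

Section RationalAngles.
Variable R : realType.
Implicit Types (x theta : R) (p q t k : nat).

Lemma cosDnatpi x k : cos (x + k%:R * pi) = (-1) ^+ k * cos x.
Proof. by rewrite mulr_natl; exact: alternatingn (@cosDpi R) k x. Qed.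

Lemma sinDnatpi x k : sin (x + k%:R * pi) = (-1) ^+ k * sin x.
Proof. by rewrite mulr_natl; exact: alternatingn (@sinDpi R) k x. Qed.

Lemma cos_natpi k : cos (k%:R * pi) = (-1) ^+ k :> R.
Proof. by rewrite -[_ * _]add0r cosDnatpi cos0 mulr1. Qed.

Lemma norm_cos1 x : 0 <= x -> `|cos x| = 1 -> exists k, x = k%:R * pi.
Proof.
move=> x0 /cos1sin0 sx; have pi0 := pi_gt0 R.
have /andP[] := truncn_itv (divr_ge0 x0 (pi_ge0 R)).
set k := Num.truncn _; rewrite ler_pdivlMr // ltr_pdivrMr // -natr1 mulrDl mul1r => kx xk.
exists k; apply/eqP; rewrite -subr_eq0; apply/negPn/negP => r0.
have : 0 < sin (x - k%:R * pi).
  by apply: sin_gt0_pi; rewrite lt_def r0 subr_ge0 kx ltrBlDl.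
move: sx; rewrite -{1}[x](subrK (k%:R * pi)) sinDnatpi => /eqP.
by rewrite mulf_eq0 signr_eq0 => /eqP ->; rewrite ltxx.
Qed.

Lemma cos_rep_acos theta p q : is_cos_rep theta (p, q) ->
  acos theta = p%:R * pi / q%:R.
Proof.
move=> [/= q0 pq _ ->]; rewrite cosK // in_itv /=.
rewrite divr_ge0 ?mulr_ge0 ?pi_ge0 ?ler0n //=.
by rewrite ler_pdivrMr ?ltr0n // mulrC ler_wpM2l ?pi_ge0 // ler_nat.
Qed.

Lemma cos_rep_unique theta (pq pq' : nat * nat) :
  is_cos_rep theta pq -> is_cos_rep theta pq' -> pq = pq'.
Proof.
case: pq pq' => [p q] [p' q'] h h'; have := cos_rep_acos h; rewrite (cos_rep_acos h').
case: h h' => /= q0 _ cpq _ [/= q'0 _ cpq' _] /eqP.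
have pi0 := lt0r_neq0 (pi_gt0 R).
rewrite eqr_div ?pnatr_eq0 -?lt0n // -!mulrA ![pi * _]mulrC !mulrA.
rewrite (inj_eq (mulIf pi0)) -!natrM eqr_nat => /eqP e.
have qq : q = q'.
  apply/eqP; rewrite eqn_dvd; apply/andP; split.
    by rewrite -(Gauss_dvdr _ (_ : coprime q p)) 1?coprime_sym // -e dvdn_mull.
  by rewrite -(Gauss_dvdr _ (_ : coprime q' p')) 1?coprime_sym // e dvdn_mull.
by move: e; rewrite qq => /eqP; rewrite eqn_pmul2r // => /eqP ->.
Qed.

(** If [t acos theta = k pi], then [k / t] in lowest terms represents
    [theta]. *)
Lemma cos_rep_exists theta t : -1 <= theta <= 1 -> (0 < t)%N ->
  `|cos (t%:R * acos theta)| = 1 -> exists pq, is_cos_rep theta pq.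
Proof.
move=> th t0 /norm_cos1[|k kE].
  by rewrite mulr_ge0 // acos_ge0.
have pi0 := pi_gt0 R; have tR : (0 : R) < t%:R by rewrite ltr0n.
have kt : (k <= t)%N.
  have := acos_lepi th; rewrite -(ler_pM2l tR) kE.
  by rewrite ler_pM2r // ler_nat.
have d0 : (0 < gcdn k t)%N by rewrite gcdn_gt0 t0 orbT.
exists (k %/ gcdn k t, t %/ gcdn k t)%N; split=> /=.
- by rewrite divn_gt0 // dvdn_leq // dvdn_gcdr.
- by rewrite leq_div2r.
- by rewrite /coprime -(eqn_pmul2r d0) muln_gcdl !divnK ?dvdn_gcdl ?dvdn_gcdr // mul1n.
have {1}-> : theta = cos (acos theta) by rewrite acosK // in_itv.
congr cos; apply: (mulfI (lt0r_neq0 tR)); rewrite kE.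
have l0 : ((t %/ gcdn k t)%N%:R : R) != 0.
  by rewrite pnatr_eq0 -lt0n divn_gt0 // dvdn_leq // dvdn_gcdr.
have kR : k%:R = (k %/ gcdn k t)%N%:R * (gcdn k t)%:R :> R.
  by rewrite -natrM divnK // dvdn_gcdl.
have tE : t%:R = (t %/ gcdn k t)%N%:R * (gcdn k t)%:R :> R.
  by rewrite -natrM divnK // dvdn_gcdr.
rewrite {}kR {}tE; by field.
Qed.

Lemma cos_rep_norm1 theta p q t : is_cos_rep theta (p, q) ->
  `|cos (t%:R * acos theta)| = 1 -> (q %| t)%N.
Proof.
move=> h; have pE := cos_rep_acos h; case: h => /= q0 _ cpq _.
rewrite pE => /norm_cos1[|k].
  by rewrite !mulr_ge0 ?invr_ge0 ?ler0n ?pi_ge0.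
have pi0 := lt0r_neq0 (pi_gt0 R); have qR : (q%:R : R) != 0 by rewrite pnatr_eq0 -lt0n.
rewrite !mulrA => /(canRL (mulfVK qR)); rewrite -!mulrA ![pi * _]mulrC !mulrA.
move=> /(mulIf pi0)/eqP; rewrite -!natrM eqr_nat => /eqP e.
by rewrite -(Gauss_dvdl _ (_ : coprime q p)) 1?coprime_sym // e dvdn_mull.
Qed.

Lemma cos_rep_cos theta p q t : is_cos_rep theta (p, q) -> (q %| t)%N ->
  cos (t%:R * acos theta) = (-1) ^+ odd ((t * p) %/ q).
Proof.
move=> h qt; rewrite (cos_rep_acos h); case: h => /= q0 _ _ _.
rewrite signr_odd -cos_natpi; congr cos.
have qR : (q%:R : R) != 0 by rewrite pnatr_eq0 -lt0n.
case/dvdnP: qt => s ->; rewrite mulnAC mulnK // !natrM; by field.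
Qed.

End RationalAngles.

(** * The mutual eigenvalue support *)

(** The equality case of the triangle inequality; [(-1) ^+ b] is the sign of the
    whole sum. *)
Lemma norm_sum_extremal (R : realType) (I : eqType) (s : seq I) (c e : I -> R) :
  {in s, forall i, `|c i| <= 1} ->
  (`|\sum_(i <- s) c i * e i| = \sum_(i <- s) `|e i|) <->
  exists b : bool, {in s, forall i, e i != 0 -> c i = (-1) ^+ (b (+) (e i < 0))}.
Proof.
move=> c1; split=> [|[b cE]]; last first.
  rewrite (_ : \sum_(i <- s) c i * e i = (-1) ^+ b * \sum_(i <- s) `|e i|).
    by rewrite normrM normr_sign mul1r ger0_norm // sumr_ge0.
  rewrite mulr_sumr big_seq [RHS]big_seq; apply: eq_bigr => i si.
  have [->|e0] := eqVneq (e i) 0; first by rewrite normr0 !mulr0.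
  by rewrite cE // signr_addb -mulrA -normrEsign.
set S := \sum_(i <- s) c i * e i; rewrite normrEsign; set b := S < 0 => sumE.
exists b => i si e0.
(* The nonnegative terms [|e j| - (-1) ^+ b * (c j * e j)] add up to 0. *)
have ge0 j : j \in s -> 0 <= `|e j| - (-1) ^+ b * (c j * e j).
  move=> sj; rewrite subr_ge0 (le_trans (ler_norm _)) // !normrM normr_sign mul1r.
  by rewrite ler_piMl // c1.
have : \sum_(j <- s) (`|e j| - (-1) ^+ b * (c j * e j)) == 0.
  by rewrite sumrB -sumE -mulr_sumr subrr.
rewrite big_seq psumr_eq0 // => /allP/(_ i si); rewrite si implyTb subr_eq0.
rewrite normrEsign mulrA (inj_eq (mulIf e0)) signr_addb => /eqP ->.
by rewrite mulrA -expr2 sqrr_sign mul1r.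
Qed.

Lemma dvdn_biglcm_seq (I : eqType) (s : seq I) (F : I -> nat) m :
  (\big[lcmn/1%N]_(i <- s) F i %| m)%N = all (fun i => F i %| m)%N s.
Proof. by elim: s => [|i s IH]; rewrite ?big_nil ?dvd1n // big_cons dvdn_lcm IH. Qed.

Lemma biglcm_seq_gt0 (I : eqType) (s : seq I) (F : I -> nat) :
  {in s, forall i, 0 < F i}%N -> (0 < \big[lcmn/1%N]_(i <- s) F i)%N.
Proof. by move=> h; rewrite big_seq; elim/big_ind: _ => // m n; rewrite lcmn_gt0 => -> ->. Qed.

Section Support.
Variables (R : realType) (n : nat) (B : 'M[R]_n) (u v : 'I_n).
Hypothesis B_sym : B^T = B.

Lemma msuppE r : msupp B u v r <-> eigenvalue B r /\ eigproj B r u v != 0.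
Proof.
rewrite /msupp /msupp_pos /msupp_neg /=; split=> [[[-> h]|[-> h]]|[-> h]].
- by rewrite gt_eqF.
- by rewrite lt_eqF.
- by move: h; rewrite neq_lt => /orP[] h; [right|left].
Qed.

(** The entries [E_r(u,v)] add up to an off-diagonal entry of the identity. *)
Lemma msupp_both_signs : u <> v -> msupp B u v !=set0 ->
  forall b : bool, exists2 r, msupp B u v r & (eigproj B r u v < 0) = b.
Proof.
move=> /eqP uv [r0 /msuppE[ev0 nz0]] b; have [rs [urs mrs s1]] := spectral_resolution B_sym.
apply: contrapT => h.
have sg r : r \in rs -> 0 <= - ((-1) ^+ b * eigproj B r u v).
  move=> rrs; have [->|nz] := eqVneq (eigproj B r u v) 0; first by rewrite mulr0 oppr0.
  have /eqP : (eigproj B r u v < 0) <> b.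
    by move=> eb; apply: h; exists r => //; apply/msuppE; rewrite -mrs.
  case: b {h} => [/eqP/negP|]; first by rewrite -leNgt mulN1r opprK.
  by rewrite eqbF_neg negbK mul1r oppr_ge0 => /ltW.
have : \sum_(r <- rs) - ((-1) ^+ b * eigproj B r u v) == 0.
  rewrite sumrN -mulr_sumr; move/matrixP/(_ u v): s1; rewrite summxE => ->.
  by rewrite mxE (negbTE uv) mulr0 oppr0.
rewrite big_seq psumr_eq0 // => /allP/(_ r0); rewrite mrs ev0 => /(_ isT).
by rewrite implyTb oppr_eq0 mulf_eq0 signr_eq0 (negbTE nz0).
Qed.

Lemma support_lcm_seq : exists2 s : seq R, (forall r, r \in s <-> msupp B u v r) &
  support_lcm B u v = \big[lcmn/1%N]_(r <- s) cos_den r.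
Proof.
have [rs [urs mrs _]] := spectral_resolution B_sym.
exists [seq r <- rs | eigproj B r u v != 0] => [r|].
  rewrite mem_filter mrs msuppE; split=> [/andP[]|[-> ->]] //.
rewrite fsbig_seq ?filter_uniq //; apply: eq_fsbigl; apply/seteqP.
by split=> r /=; rewrite mem_filter mrs msuppE; [move=> [-> ->]|move=> /andP[-> ->]].
Qed.

Lemma support_lcm_dvd m :
  (support_lcm B u v %| m)%N <-> forall r, msupp B u v r -> (cos_den r %| m)%N.
Proof.
have [s sE ->] := support_lcm_seq; rewrite dvdn_biglcm_seq.
by split=> [/allP h r /sE|h]; [exact: h|apply/allP => r /sE; exact: h].
Qed.

Lemma support_lcm_gt0 : (forall r, msupp B u v r -> (0 < cos_den r)%N) ->
  (0 < support_lcm B u v)%N.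
Proof.
by have [s sE ->] := support_lcm_seq => h; apply: biglcm_seq_gt0 => r /sE /h.
Qed.

Lemma cos_repP (theta : R) : (exists pq, is_cos_rep theta pq) ->
  is_cos_rep theta (cos_num theta, cos_den theta).
Proof.
move=> [pq h]; rewrite /cos_num /cos_den -surjective_pairing /cos_rep.
by case: xgetP => [pq' _ //|/(_ pq)].
Qed.

Lemma support_cosinesE :
  support_cosines B u v <->
  forall r, msupp B u v r -> is_cos_rep r (cos_num r, cos_den r).
Proof.
split=> h r /h; first by move=> [pq [hpq _]]; apply: cos_repP; exists pq.
by move=> hr; exists (cos_num r, cos_den r); split=> // pq; exact: cos_rep_unique.
Qed.

(** The parity condition with the sign [gamma] encoded as [(-1) ^+ b]. *)
Lemma support_parityE : support_parity B u v <-> exists b : bool,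
  forall r, msupp B u v r ->
    odd (support_multiple B u v r) = b (+) (eigproj B r u v < 0).
Proof.
have pos r : msupp B u v r -> (msupp_pos B u v r <-> ~~ (eigproj B r u v < 0)).
  move=> /msuppE[ev nz]; rewrite /msupp_pos /=.
  by rewrite -leNgt le_eqVlt eq_sym (negbTE nz) /=; split=> [[]|].
have neg r : msupp B u v r -> (msupp_neg B u v r <-> eigproj B r u v < 0).
  by move=> /msuppE[ev nz]; rewrite /msupp_neg /=; split=> [[]|].
(* These let [tauto] interpret the boolean constants. *)
have T : true by []. have F : ~ false by [].
split=> [[gamma [g1 h]]|[b h]].
  exists (gamma != 1) => r mr; have [] := h r mr.
  have := pos r mr; have := neg r mr.
  case: g1 => ->; rewrite /msupp_sign /=;
  by case: odd; case: (_ < 0) => //=; tauto.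
exists ((-1) ^+ b); split; first by case: b {h}; [right|left].
move=> r mr; have := pos r mr; have := neg r mr; rewrite (h r mr).
by case: b {h}; rewrite /msupp_sign /=; case: (_ < 0) => /=; tauto.
Qed.

End Support.

(** * Peak state transfer *)

Section PeakStateTransfer.
Variables (R : realType) (a x y : nat).
Variables (N : 'M[R]_(a, x)) (M : 'M[R]_(a, y)).
Hypotheses (hN : N^T *m N = 1%:M) (hM : M^T *m M = 1%:M).
Variables u v : 'I_x.

Local Notation B := (projected_transition N M).

Let B_sym : B^T = B := projected_transition_sym M hN.

Lemma msupp_itv r : msupp B u v r -> -1 <= r <= 1.
Proof. by move=> /msuppE[/(eigenvalue_projected hN hM)]. Qed.

Lemma projected_power_entry (rs : seq R) t : (forall r, (r \in rs) = eigenvalue B r) ->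
  \sum_(r <- rs) eigproj B r = 1%:M ->
  projected_power N M t u v = \sum_(r <- rs) cos (t%:R * acos r) * eigproj B r u v.
Proof.
move=> mrs s1; rewrite (projected_power_spectral hN hM mrs s1) summxE.
by apply: eq_bigr => r _; rewrite mxE.
Qed.

Lemma peak_sumE (rs : seq R) : uniq rs -> (forall r, (r \in rs) = eigenvalue B r) ->
  \sum_(r \in [set r | eigenvalue B r]) `|eigproj B r u v| =
  \sum_(r <- rs) `|eigproj B r u v|.
Proof.
move=> urs mrs; rewrite [RHS]fsbig_seq //; apply: eq_fsbigl; apply/seteqP.
by split=> r /=; rewrite mrs.
Qed.

(** Peak state transfer at [t]: up to a global sign, each [cos (t acos r)] is the
    sign of [E_r(u,v)]. *)
Lemma peakE t : peak_state_transfer N M u v t <-> exists b : bool,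
  forall r, msupp B u v r -> cos (t%:R * acos r) = (-1) ^+ (b (+) (eigproj B r u v < 0)).
Proof.
have [rs [urs mrs s1]] := spectral_resolution B_sym.
rewrite /peak_state_transfer (peak_sumE urs mrs) (projected_power_entry t mrs s1).
rewrite norm_sum_extremal; last by move=> r _; exact: cos_max.
split=> -[b h]; exists b => r.
  by move=> /msuppE[]; rewrite -mrs; exact: h.
by rewrite mrs => ev nz; apply: h; apply/msuppE.
Qed.

Lemma peak_conditions t : u <> v -> msupp B u v !=set0 -> (0 < t)%N ->
  peak_state_transfer N M u v t ->
  [/\ support_cosines B u v, support_parity B u v &
      exists2 k, odd k & t = (k * support_lcm B u v)%N].
Proof.
move=> uv L0 t0 /peakE[b hb].
have norm1 r : msupp B u v r -> `|cos (t%:R * acos r)| = 1.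
  by move=> /hb ->; rewrite normr_sign.
have rep r : msupp B u v r -> is_cos_rep r (cos_num r, cos_den r).
  move=> mr; apply: cos_repP; exact: cos_rep_exists (msupp_itv mr) t0 (norm1 r mr).
have : (support_lcm B u v %| t)%N.
  by apply/(support_lcm_dvd _ _ B_sym) => r mr; exact: cos_rep_norm1 (rep r mr) (norm1 r mr).
case/dvdnP=> k tk.
have par r : msupp B u v r ->
    odd k && odd (support_multiple B u v r) = b (+) (eigproj B r u v < 0).
  move=> mr; apply: (@signr_inj R); rewrite -(hb r mr).
  have dl : (cos_den r %| support_lcm B u v)%N.
    by move: r mr; apply/(support_lcm_dvd _ _ B_sym).
  rewrite (cos_rep_cos (rep r mr)) tk ?dvdn_mull //.
  by rewrite -mulnA -muln_divA ?dvdn_mulr // oddM.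
have ok : odd k.
  apply/negPn/negP => /negbTE ok.
  (* For even [k] all signs agree with [b]; pick an [r] of the other sign. *)
  have [r mr rb] := msupp_both_signs B_sym uv L0 (~~ b).
  by have := par r mr; rewrite ok rb addbN addbb.
split; last by exists k.
  exact/support_cosinesE.
by apply/support_parityE; exists b => r mr; rewrite -par // ok.
Qed.

Lemma peak_odd_multiple k : support_cosines B u v -> support_parity B u v -> odd k ->
  peak_state_transfer N M u v (k * support_lcm B u v).
Proof.
move=> /support_cosinesE rep /support_parityE[b hb] ok; apply/peakE; exists b => r mr.
have dl : (cos_den r %| support_lcm B u v)%N.
  by move: r mr; apply/(support_lcm_dvd _ _ B_sym).
rewrite (cos_rep_cos (rep r mr)) ?dvdn_mull // -mulnA -muln_divA ?dvdn_mulr //.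
by rewrite oddM ok -hb.
Qed.

Lemma support_lcm_pos : support_cosines B u v -> (0 < support_lcm B u v)%N.
Proof. by move=> /support_cosinesE rep; apply: support_lcm_gt0 => // r /rep[]. Qed.

End PeakStateTransfer.

(** * Perfect state transfer *)

Section PerfectStateTransfer.
Variables (R : realType) (a x y : nat).
Variables (N : 'M[R]_(a, x)) (M : 'M[R]_(a, y)).
Hypotheses (hN : N^T *m N = 1%:M) (hM : M^T *m M = 1%:M).
Variables u v : 'I_x.

Local Notation B := (projected_transition N M).

Let B_sym : B^T = B := projected_transition_sym M hN.

Lemma projected_power_sym t : (projected_power N M t)^T = projected_power N M t.
Proof.
have [rs [urs mrs s1]] := spectral_resolution B_sym.
rewrite (projected_power_spectral hN hM mrs s1) linear_sum; apply: eq_bigr => r _.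
by rewrite /= linearZ /= eigproj_symmetric.
Qed.

Lemma normc_real (b : R) : `|real_complex R b| = real_complex R `|b|.
Proof. by rewrite normc_def /= expr0n addr0 sqrtr_sqr. Qed.

(** Since [V = U^t N] has orthonormal columns and [b = B_t(u,v)] satisfies
    [b ^+ 2 = 1], the squared norm of [V e_u - b N e_v] vanishes.  The phase is
    therefore [b]. *)
Lemma perfectE t :
  perfect_state_transfer N M u v t <-> `|projected_power N M t u v| = 1.
Proof.
set V := transition N M ^+ t *m N.
have NV : N^T *m V = projected_power N M t by rewrite /V mulmxA.
have VV : V^T *m V = 1%:M.
  rewrite trmx_mul -mulmxA (mulmxA _^T (_ ^+ t)).
  by rewrite (transition_pow_orthogonal hN hM) mul1mx.
rewrite /perfect_state_transfer -/V; clearbody V.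
pose f := real_complex R.
have stdE : forall i, stdvec R[i] i = map_mx f (stdvec R i : 'cV_x).
  by move=> i; rewrite /stdvec /f map_delta_mx.
split=> [[g g1]|h].
  rewrite !stdE -!map_mxM -/f /= => /(congr1 (mulmx (map_mx f N^T))).
  rewrite -scalemxAr -!map_mxM !mulmxA NV hN mul1mx => /colP/(_ v).
  have colA (A : 'M[R]_x) i j : col i A j 0 = A j i by rewrite mxE.
  rewrite /stdvec -colE [LHS]mxE colA /f map_delta_mx [RHS]mxE [X in _ * X]mxE.
  rewrite !eqxx mulr1 => gE.
  have Bvu : projected_power N M t v u = projected_power N M t u v.
    by rewrite -{1}projected_power_sym [LHS]mxE.
  by move: g1; rewrite -gE Bvu normc_real => -[].
set b := projected_power N M t u v in h.
exists (f b); first by rewrite normc_real h.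
have b2 : b ^+ 2 = 1 by rewrite -real_normK ?num_real // h expr1n.
rewrite !stdE -!map_mxM -map_mxZ; congr map_mx.
apply/eqP; rewrite -subr_eq0; apply/eqP/col_norm_eq0.
have -> : (V *m stdvec R u - b *: (N *m stdvec R v))^T *m
    (V *m stdvec R u - b *: (N *m stdvec R v)) =
    (stdvec R u)^T *m (V^T *m V) *m stdvec R u
    - b *: ((stdvec R v)^T *m (N^T *m V) *m stdvec R u)
    - b *: ((stdvec R u)^T *m (N^T *m V)^T *m stdvec R v)
    + b ^+ 2 *: ((stdvec R v)^T *m (N^T *m N) *m stdvec R v).
  have -> (P Q : 'cV[R]_a) : (P - b *: Q)^T = P^T - b *: Q^T by rewrite linearB linearZ.
  rewrite !trmx_mul trmxK mulmxBr !mulmxBl -!scalemxAr -!scalemxAl.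
  by rewrite !mulmxA scalerA -expr2 opprB addrA addrAC.
rewrite VV NV hN !mulmx1 projected_power_sym.
have ent (A : 'M[R]_x) i j : ((stdvec R i)^T *m A *m stdvec R j) 0 0 = A i j.
  by rewrite /stdvec trmx_delta -rowE -colE !mxE.
have ent1 (i : 'I_x) : ((stdvec R i)^T *m stdvec R i) 0 0 = 1.
  by have := ent 1%:M i i; rewrite mulmx1 [RHS]mxE eqxx.
have Bvu : projected_power N M t v u = b by rewrite -projected_power_sym [LHS]mxE.
have E4 (A1 A2 A3 A4 : 'M[R]_1) (c d : R) : (A1 - c *: A2 - c *: A3 + d *: A4) 0 0 =
    A1 0 0 - c * A2 0 0 - c * A3 0 0 + d * A4 0 0 by rewrite !mxE.
by rewrite E4 !ent !ent1 Bvu -/b -expr2 b2; ring.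
Qed.

Lemma perfect_peak_cospectral t : perfect_state_transfer N M u v t ->
  peak_state_transfer N M u v t /\ strongly_cospectral B u v.
Proof.
move=> /perfectE b1; have [rs [urs mrs s1]] := spectral_resolution B_sym.
rewrite /peak_state_transfer (peak_sumE u v urs mrs) b1.
have tr1 w : \sum_(r <- rs) eigproj B r w w = 1.
  by move/matrixP/(_ w w): s1; rewrite summxE mxE eqxx.
have avg : \sum_(r <- rs) (eigproj B r u u + eigproj B r v v) / 2 = 1.
  by rewrite -mulr_suml big_split /= !tr1; lra.
(* [1 = |B_t(u,v)| <= \sum |E_r(u,v)| <= \sum (E_r(u,u) + E_r(v,v)) / 2 = 1]. *)
have le1 : 1 <= \sum_(r <- rs) `|eigproj B r u v|.
  rewrite -b1 (projected_power_entry hN hM u v t mrs s1) (le_trans (ler_norm_sum _ _ _)) //.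
  by apply: ler_sum => r _; rewrite normrM ler_piMl // cos_max.
have sum1 : \sum_(r <- rs) `|eigproj B r u v| = 1.
  apply/eqP; rewrite eq_le le1 andbT -avg; apply: ler_sum => r _.
  exact: eigproj_entry_le.
split=> // r ev; apply: eigproj_entry_max => //.
have : \sum_(r <- rs) ((eigproj B r u u + eigproj B r v v) / 2 - `|eigproj B r u v|) == 0.
  by rewrite sumrB avg sum1 subrr.
rewrite psumr_eq0 => [/allP/(_ r)|s _]; last by rewrite subr_ge0 eigproj_entry_le.
by rewrite mrs ev implyTb subr_eq0 => /(_ isT)/eqP.
Qed.

Lemma peak_cospectral_perfect t : peak_state_transfer N M u v t ->
  strongly_cospectral B u v -> perfect_state_transfer N M u v t.
Proof.
have [rs [urs mrs s1]] := spectral_resolution B_sym.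
rewrite /peak_state_transfer (peak_sumE u v urs mrs) => pk sc; apply/perfectE.
have <- : \sum_(r <- rs) eigproj B r u u = 1.
  by move/matrixP/(_ u u): s1; rewrite summxE mxE eqxx.
rewrite pk.
rewrite big_seq [RHS]big_seq; apply: eq_bigr => r; rewrite mrs => /sc.
exact: cospectral_entry.
Qed.

End PerfectStateTransfer.

Theorem theorem3p5 (R : realType) (a x y : nat)
    (N : 'M[R]_(a, x)) (M : 'M[R]_(a, y))
    (hN : N^T *m N = 1%:M) (hM : M^T *m M = 1%:M)
    (B : 'M[R]_x) (hB : B = projected_transition N M)
    (u v : 'I_x) (huv : u <> v) (hL : msupp B u v !=set0) :
  [/\ (exists2 t : nat, (0 < t)%N & peak_state_transfer N M u v t) <->
        support_cosines B u v /\ support_parity B u v,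
      (exists2 t : nat, (0 < t)%N & peak_state_transfer N M u v t) ->
        forall t : nat, (0 < t)%N ->
          (peak_state_transfer N M u v t <->
           exists2 k : nat, odd k & t = (k * support_lcm B u v)%N),
      forall t : nat, (0 < t)%N -> peak_state_transfer N M u v t ->
        (perfect_state_transfer N M u v t <->
         [/\ support_cosines B u v, support_parity B u v &
             strongly_cospectral B u v]) &
      (exists2 t : nat, (0 < t)%N & perfect_state_transfer N M u v t) <->
        [/\ support_cosines B u v, support_parity B u v &
            strongly_cospectral B u v] ].
Proof.
subst B; have necessary := peak_conditions hN hM huv hL.
have peak_tau : support_cosines (projected_transition N M) u v ->
    support_parity (projected_transition N M) u v ->
    exists2 t, (0 < t)%N & peak_state_transfer N M u v t.
  move=> sc sp; exists (1 * support_lcm (projected_transition N M) u v)%N.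
    by rewrite mul1n (support_lcm_pos hN).
  exact: (peak_odd_multiple hN hM).
split.
- by split=> [[t t0 /necessary[]]|[]].
- move=> [t0 t0_gt0 /necessary[] // sc sp _] t t_gt0.
  split=> [/necessary[] //|[k ok ->]]; exact: (peak_odd_multiple hN hM).
- move=> t t_gt0 pk; split=> [/(perfect_peak_cospectral hN hM)[_ cosp]|[_ _ cosp]].
    by have [] := necessary t t_gt0 pk.
  exact: peak_cospectral_perfect.
- split=> [[t t_gt0 /(perfect_peak_cospectral hN hM)[pk cosp]]|[sc sp cosp]].
    by have [] := necessary t t_gt0 pk.
  have [t t_gt0 pk] := peak_tau sc sp; exists t => //.
  exact: peak_cospectral_perfect.
Qed.
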